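(* Let $M^3(\phi,\xi,\eta,g)$ be an $\alpha$-para Kenmotsu manifold. Then $M^3$ is $\xi$-concircularly flat (that is, $L(X,Y)\xi=0$ for all vector fields $X,Y$ on $M^3$) if and only if the scalar curvature satisfies $\tau=6\alpha^2$ on $M^3$.
   Context: All manifolds are smooth and connected. An almost paracontact metric structure on a 3-manifold $M^3$ is a quadruple $(\phi,\xi,\eta,g)$, where $\phi$ is a $(1,1)$-tensor field, $\xi$ a vector field, $\eta$ a 1-form and $g$ a pseudo-Riemannian metric of signature $(2,1)$, with $\phi^2=I-\eta\otimes\xi$, $\eta(\xi)=1$, the eigendistributions of $\phi$ restricted to $D=\ker\eta$ for the eigenvalues $+1$ and $-1$ having equal rank $1$, and $g(\phi X,\phi Y)=-g(X,Y)+\eta(X)\eta(Y)$ for all $X,Y$. Consequently $\phi\xi=0$, $\eta\circ\phi=0$, $\eta(X)=g(X,\xi)$ and $g(\phi X,Y)=-g(X,\phi Y)$. The structure is normal if $[\phi,\phi]-2d\eta\otimes\xi=0$, where $[\phi,\phi](X,Y)=\phi^2[X,Y]+[\phi X,\phi Y]-\phi[\phi X,Y]-\phi[X,\phi Y]$ and $2d\eta(X,Y)=X\eta(Y)-Y\eta(X)-\eta([X,Y])$. In dimension 3 it is known that normality is equivalent to the existence of smooth functions $\alpha,\beta$ with $\nabla_X\xi=\alpha(X-\eta(X)\xi)+\beta\phi X$ for all $X$, and also equivalent to $(\nabla_X\phi)Y=\beta(g(X,Y)\xi-\eta(Y)X)+\alpha(g(\phi X,Y)\xi-\eta(Y)\phi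 X)$ for all $X,Y$ (same functions $\alpha,\beta$), where $\nabla$ is the Levi-Civita connection of $g$; here $2\alpha=\mathrm{trace}\{X\mapsto\nabla_X\xi\}$ and $2\beta=\mathrm{trace}\{X\mapsto\phi\nabla_X\xi\}$. A normal almost paracontact metric 3-manifold is called $\alpha$-para Kenmotsu if $\alpha$ is a non-zero constant and $\beta=0$. Curvature conventions: $R(X,Y)Z=\nabla_{[X,Y]}Z-[\nabla_X,\nabla_Y]Z$; the Ricci tensor is $Ric(Y,Z)=\mathrm{trace}\{X\mapsto R(X,Y)Z\}$; the Ricci operator $S$ is given by $g(SX,Y)=Ric(X,Y)$; the scalar curvature is $\tau=\mathrm{trace}(S)$. The concircular curvature tensor of a $(2n+1)$-dimensional pseudo-Riemannian manifold is $L(X,Y)Z=R(X,Y)Z-\frac{\tau}{2n(2n+1)}\bigl(g(Y,Z)X-g(X,Z)Y\bigr)$; thus in dimension 3 the coefficient is $\frac{\tau}{6}$. A normal almost paracontact metric manifold is called $\xi$-concircularly flat if $L(X,Y)\xi=0$ holds for all vector fields $X,Y$. *)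

(* Defs.v *)
From HB Require Import structures.
From mathcomp Require Import all_boot all_order all_algebra.
From mathcomp Require Import all_classical all_reals all_analysis.
From mathcomp Require Import ring.

Set Implicit Arguments.
Unset Strict Implicit.
Unset Printing Implicit Defensive.

Import Order.TTheory GRing.Theory Num.Theory.
Import numFieldNormedType.Exports.

Local Open Scope classical_set_scope.
Local Open Scope ring_scope.

Section SmoothOn.
Context {R : realType} {N : nat}.
Implicit Types (U : set 'rV[R]_N) (f g : 'rV[R]_N -> R).

(* C^k on U; meant for open U, where the values of f outside U are irrelevant.
   Quantifying over all directions v, and not only over the coordinate ones, is
   harmless since f is required to be differentiable. *)
Fixpoint Ck k U f : Prop :=
  if k is k'.+1 then
    (forall x, U x -> differentiable f x) /\
    (forall v, Ck k' U (fun x => 'D_v f x))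
  else forall x, U x -> {for x, continuous f}.

Definition smooth_on U f := forall k, Ck k U f.

Lemma near_eq_differentiable f g x :
  (\forall y \near x, f y = g y) -> differentiable f x -> differentiable g x.
Proof.
move=> fg df; have [df_cont dfE] := (diff_locallyP x f).1 df.
have gE : g \o shift x = cst (g x) + 'd f x +o_ 0 id.
  apply/eqaddoP => _/posnumP[e].
  have /eqaddoP/(_ e%:num (gt0 e)) fo := dfE.
  have fg0 : \forall h \near (0 : 'rV[R]_N), f (h + x) = g (h + x).
    by move: fg; rewrite (near_shift 0 x) /=; apply: filterS => h /=; rewrite subr0.
  near=> h.
  have -> : (g \o shift x - (cst (g x) + 'd f x)) h
          = (f \o shift x - (cst (f x) + 'd f x)) h.
    rewrite /GRing.add /GRing.opp /= -(nbhs_singleton fg).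
    by congr (_ - _); near: h; apply: filterS fg0.
  by near: h.
by apply/diff_locallyP; rewrite (diff_unique df_cont gE).
Unshelve. all: by end_near. Qed.

Lemma Ck_ext k U f g : open U -> (forall x, U x -> f x = g x) ->
  Ck k U f -> Ck k U g.
Proof.
move=> Uo; have nfg f1 g1 x : (forall x, U x -> f1 x = g1 x) -> U x ->
    \forall y \near x, f1 y = g1 y.
  by move=> fg Ux; apply: filterS (open_nbhs_nbhs (conj Uo Ux)) => y; exact: fg.
elim: k f g => [|k IHk] f g fg /=.
  move=> fc x Ux; rewrite /prop_for /continuous_at -(fg _ Ux).
  exact: cvg_trans (near_eq_cvg (nfg f g x fg Ux)) (fc x Ux).
move=> [df Df]; split=> [x Ux|v].
  by apply: near_eq_differentiable (df x Ux); exact: nfg.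
by apply: IHk (Df v) => x Ux; apply: near_eq_derive; exact: nfg.
Qed.

Lemma CkSW k U f : Ck k.+1 U f -> Ck k U f.
Proof.
elim: k f => [|k IHk] f [df Df].
  by move=> x Ux; exact/differentiable_continuous/df.
by split=> // v; apply: IHk; exact: Df.
Qed.

Lemma Ck_cst k U a : Ck k U (cst a).
Proof.
elim: k a => [|k IHk] a; first by move=> x _; exact: cst_continuous.
split=> [x _|v]; first exact: differentiable_cst.
by under eq_fun do rewrite derive_cst; exact: IHk.
Qed.

Lemma CkD k U f g : open U -> Ck k U f -> Ck k U g -> Ck k U (f + g).
Proof.
move=> Uo; elim: k f g => [|k IHk] f g /=.
  by move=> fc gc x Ux; apply: continuousD; [exact: fc|exact: gc].
move=> [df Df] [dg Dg]; split=> [x Ux|v].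
  by apply: differentiableD; [exact: df|exact: dg].
apply: Ck_ext (IHk _ _ (Df v) (Dg v)) => // x Ux.
by rewrite deriveD //; apply: diff_derivable; [exact: df|exact: dg].
Qed.

Lemma CkM k U f g : open U -> Ck k U f -> Ck k U g -> Ck k U (f * g).
Proof.
move=> Uo; elim: k f g => [|k IHk] f g.
  by move=> fc gc x Ux; apply: continuousM; [exact: fc|exact: gc].
move=> Cf Cg; have [df Df] := Cf; have [dg Dg] := Cg; split=> [x Ux|v].
  by apply: differentiableM; [exact: df|exact: dg].
have fDg := IHk _ _ (CkSW Cf) (Dg v); have gDf := IHk _ _ (CkSW Cg) (Df v).
apply: Ck_ext (CkD Uo fDg gDf) => // x Ux.
by rewrite deriveM //; apply: diff_derivable; [exact: df|exact: dg].
Qed.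

End SmoothOn.

(* A chart is a homeomorphism between open sets of M and R^N; [chart_map] and
   [chart_inv] are total, with arbitrary values off [chart_dom], resp. off
   [chart_img]. *)
Record chart (R : realType) (N : nat) (M : topologicalType) := Chart {
  chart_dom : set M;
  chart_map : M -> 'rV[R]_N;
  chart_inv : 'rV[R]_N -> M;
  chart_dom_open : open chart_dom;
  chart_img_open : open (chart_map @` chart_dom);
  chart_mapK : forall p, chart_dom p -> chart_inv (chart_map p) = p;
  chart_map_cont : forall p, chart_dom p -> {for p, continuous chart_map};
  chart_inv_cont : forall x, (chart_map @` chart_dom) x ->
    {for x, continuous chart_inv}
}.

Definition chart_img R N M (c : chart R N M) : set 'rV[R]_N :=
  chart_map c @` chart_dom c.

Definition chart_compatible R N M (c d : chart R N M) :=
  forall j : 'I_N,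
    smooth_on (chart_map c @` (chart_dom c `&` chart_dom d))
              (fun x => chart_map d (chart_inv c x) 0 j).

Record manifold (R : realType) (N : nat) := Manifold {
  carrier :> topologicalType;
  atlas : set (chart R N carrier);
  manifold_hausdorff : hausdorff_space carrier;
  manifold_second_countable : @second_countable carrier;
  manifold_connected : connected [set: carrier];
  atlas_cover : forall p, exists2 c, atlas c & chart_dom c p;
  atlas_compatible : forall c d, atlas c -> atlas d -> chart_compatible c d
}.

Section SmoothFunctions.
Context {R : realType} {N : nat} (M : manifold R N).

Definition smooth (f : M -> R) :=
  forall c, atlas c -> smooth_on (chart_img c) (f \o chart_inv c).

Definition smooth_pred : {pred M -> R} := fun f => `[< smooth f >].

Record cinf := Cinf { cinf_fun :> M -> R; cinf_mem : cinf_fun \in smooth_pred }.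

HB.instance Definition _ := [isSub for cinf_fun].
HB.instance Definition _ := [Choice of cinf by <:].

Lemma cinf_smooth (f : cinf) : smooth f.
Proof. by apply/asboolP; exact: cinf_mem. Qed.

Lemma smooth_cst a : smooth (cst a).
Proof. by move=> c _ k; exact: Ck_cst. Qed.

Lemma smoothD f g : smooth f -> smooth g -> smooth (f + g).
Proof.
move=> sf sg c ac k.
exact: (CkD (@chart_img_open _ _ _ c) (sf c ac k) (sg c ac k)).
Qed.

Lemma smoothM f g : smooth f -> smooth g -> smooth (f * g).
Proof.
move=> sf sg c ac k.
exact: (CkM (@chart_img_open _ _ _ c) (sf c ac k) (sg c ac k)).
Qed.

Lemma smoothZ a f : smooth f -> smooth (a *: f).
Proof. by move=> sf; exact: (smoothM (smooth_cst a) sf). Qed.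

Lemma smooth_subring : subring_closed smooth_pred.
Proof.
split=> [|f g /asboolP sf /asboolP sg|f g /asboolP sf /asboolP sg];
  apply/asboolP.
- exact: smooth_cst.
- by rewrite -scaleN1r; apply: smoothD => //; exact: smoothZ.
- exact: smoothM.
Qed.

Lemma smooth_submod : submod_closed smooth_pred.
Proof.
split=> [|a f g /asboolP sf /asboolP sg]; apply/asboolP.
- exact: smooth_cst.
- by apply: smoothD => //; exact: smoothZ.
Qed.

HB.instance Definition _ :=
  GRing.SubChoice_isSubComPzRing.Build _ _ cinf smooth_subring.
HB.instance Definition _ :=
  GRing.SubZmodule_isSubLmodule.Build R (M -> R) _ cinf smooth_submod.

Lemma cinf_eq (f g : cinf) : (forall p, f p = g p) -> f = g.
Proof. by move=> fg; apply/val_inj/funext. Qed.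

Lemma cinfD (f g : cinf) p : (f + g) p = f p + g p. Proof. by []. Qed.
Lemma cinfN (f : cinf) p : (- f) p = - f p. Proof. by []. Qed.
Lemma cinfM (f g : cinf) p : (f * g) p = f p * g p. Proof. by []. Qed.
Lemma cinfZ (a : R) (f : cinf) p : (a *: f) p = a * f p. Proof. by []. Qed.
Definition cinfE := (cinfD, cinfN, cinfM, cinfZ).

Definition mk_cinf (f : M -> R) (sf : smooth f) : cinf := Cinf (asboolT sf).

Definition cinf_cst (a : R) : cinf := mk_cinf (smooth_cst a).

End SmoothFunctions.

Section Tangent.
Context {R : realType} {N : nat} {M : manifold R N}.

Definition is_derivation_at (p : M) (v : cinf M -> R) :=
  (forall (a : R) (f g : cinf M), v (a *: f + g) = a * v f + v g) /\
  (forall f g : cinf M, v (f * g) = f p * v g + g p * v f).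

Definition tangent_pred (p : M) : {pred cinf M -> R} :=
  fun v => `[< is_derivation_at p v >].

Record tangent (p : M) := Tangent {
  tangent_fun :> cinf M -> R;
  tangent_mem : tangent_fun \in tangent_pred p
}.

HB.instance Definition _ p := [isSub for @tangent_fun p].
HB.instance Definition _ p := [Choice of tangent p by <:].

Lemma tangentP p (v : tangent p) : is_derivation_at p v.
Proof. by apply/asboolP; exact: tangent_mem. Qed.

Lemma tangent_submod p : submod_closed (tangent_pred p).
Proof.
split=> [|b u v /asboolP[uL uM] /asboolP[vL vM]]; apply/asboolP; split.
- by move=> a f g; rewrite /GRing.zero /= mulr0 addr0.
- by move=> f g; rewrite /GRing.zero /= !mulr0 addr0.
- move=> a f g; have E h : (b *: u + v) h = b * u h + v h by [].
  by rewrite !E uL vL !mulrDr addrACA mulrCA.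
- move=> f g; have E h : (b *: u + v) h = b * u h + v h by [].
  by rewrite !E uM vM !mulrDr addrACA !(mulrCA b).
Qed.

HB.instance Definition _ p :=
  GRing.SubChoice_isSubLmodule.Build R (cinf M -> R) _ (tangent p)
    (tangent_submod p).

(* Smooth vector fields, as derivations of the algebra of smooth functions;
   (X f) p is written X f p, and [vf_at X p] is the value of X at p. *)
Definition is_derivation (X : cinf M -> cinf M) :=
  (forall (a : R) (f g : cinf M), X (a *: f + g) = a *: X f + X g) /\
  (forall f g : cinf M, X (f * g) = f * X g + g * X f).

Definition vf_pred : {pred cinf M -> (cinf M)^o} :=
  fun X => `[< is_derivation X >].

Record vf := VF {
  vf_fun :> cinf M -> (cinf M)^o;
  vf_mem : vf_fun \in vf_pred
}.

HB.instance Definition _ := [isSub for vf_fun].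
HB.instance Definition _ := [Choice of vf by <:].

Lemma vfP (X : vf) : is_derivation X.
Proof. by apply/asboolP; exact: vf_mem. Qed.

Lemma vf_submod : submod_closed vf_pred.
Proof.
split=> [|b u v /asboolP[uL uM] /asboolP[vL vM]]; apply/asboolP; split.
- move=> a f g; have E h : (0 : cinf M -> (cinf M)^o) h = 0 by [].
  by rewrite !E scaler0 addr0.
- move=> f g; have E h : (0 : cinf M -> (cinf M)^o) h = 0 by [].
  by rewrite !E !mulr0 addr0.
- move=> a f g; have E h : (b *: u + v) h = b * u h + v h by [].
  rewrite !E uL vL; apply: cinf_eq => p.
  by rewrite !cinfE; ring.
- move=> f g; have E h : (b *: u + v) h = b * u h + v h by [].
  by rewrite !E uM vM !mulrDr addrACA !(mulrCA b).
Qed.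

HB.instance Definition _ :=
  GRing.SubChoice_isSubLmodule.Build (cinf M) (cinf M -> (cinf M)^o) _ vf
    vf_submod.

Fact vf_at_subproof (X : vf) p : (fun f => X f p) \in tangent_pred p.
Proof.
have [XL XM] := vfP X; apply/asboolP.
by split=> [a f g|f g]; rewrite ?XL ?XM.
Qed.

Definition vf_at (X : vf) (p : M) : tangent p := Tangent (vf_at_subproof X p).

(* The vector field whose value at p is v p. *)
Fact mk_vf_subproof (v : forall p, tangent p)
    (sv : forall f : cinf M, smooth (fun p => v p f)) :
  (fun f => mk_cinf (sv f) : (cinf M)^o) \in vf_pred.
Proof.
apply/asboolP; split=> [a f g|f g]; apply: cinf_eq => p /=.
  by rewrite (tangentP (v p)).1.
by rewrite (tangentP (v p)).2.
Qed.

Definition mk_vf v sv : vf := VF (@mk_vf_subproof v sv).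

Fact bracket_subproof (X Y : vf) :
  (fun f => X (Y f) - Y (X f) : (cinf M)^o) \in vf_pred.
Proof.
have [XL XM] := vfP X; have [YL YM] := vfP Y.
have XD f g : X (f + g) = X f + X g.
  by have := XL 1 f g; rewrite !scale1r.
have YD f g : Y (f + g) = Y f + Y g.
  by have := YL 1 f g; rewrite !scale1r.
apply/asboolP; split=> [a f g|f g].
  rewrite YL XL XL YL; apply: cinf_eq => p.
  by rewrite !cinfE; ring.
rewrite YM XM XD YD !XM !YM; apply: cinf_eq => p.
by rewrite !cinfE; ring.
Qed.

Definition bracket (X Y : vf) : vf := VF (bracket_subproof X Y).

End Tangent.

Arguments vf {R N} M.

Section Tensors.
Context {R : realType} {N : nat} {M : manifold R N}.

Record one_form := OneForm {
  one_form_at :> forall p : M, {scalar tangent p};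
  one_form_smooth : forall X : vf M, smooth (fun p => one_form_at p (vf_at X p))
}.

Record endo_field := EndoField {
  endo_at :> forall p : M, {linear tangent p -> tangent p};
  endo_smooth : forall (X : vf M) (f : cinf M),
    smooth (fun p => endo_at p (vf_at X p) f)
}.

Record pseudo_metric := PseudoMetric {
  metric_at :> forall p : M, tangent p -> tangent p -> R;
  metric_sym : forall p (u v : tangent p), metric_at u v = metric_at v u;
  metric_linear : forall p a (u v w : tangent p),
    metric_at (a *: u + v) w = a * metric_at u w + metric_at v w;
  metric_nondeg : forall p (u : tangent p),
    (forall v, metric_at u v = 0) -> u = 0;
  metric_smooth : forall X Y : vf M,
    smooth (fun p => metric_at (vf_at X p) (vf_at Y p))
}.

Definition app_form (eta : one_form) (X : vf M) : cinf M :=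
  mk_cinf (one_form_smooth eta X).

Definition app_endo (phi : endo_field) (X : vf M) : vf M :=
  mk_vf (endo_smooth phi X).

Definition app_metric (g : pseudo_metric) (X Y : vf M) : cinf M :=
  mk_cinf (metric_smooth g X Y).

(* e is a basis of the linear subspace P of V. *)
Definition is_basis (V : lmodType R) (P : set V) k (e : 'I_k -> V) :=
  (forall i, P (e i)) /\
  (forall v, P v -> exists! a : 'rV[R]_k, v = \sum_i a 0 i *: e i).

Definition has_dim (V : lmodType R) (P : set V) k :=
  exists e : 'I_k -> V, is_basis P e.

Definition has_signature (g : pseudo_metric) (r s : nat) :=
  forall p : M, exists e : 'I_(r + s) -> tangent p,
    is_basis setT e /\
    forall i j, g p (e i) (e j) =
      if i == j then (if (i < r)%N then 1 else -1) else 0.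

(* The set is a singleton when V has dimension N and F is linear. *)
Definition trace (V : lmodType R) (F : V -> V) : R :=
  xget 0 [set t | exists (e : 'I_N -> V) (A : 'M[R]_N),
    [/\ is_basis setT e,
        forall j, F (e j) = \sum_i A i j *: e i
      & t = \tr A]].

End Tensors.

Arguments one_form {R N} M.
Arguments endo_field {R N} M.
Arguments pseudo_metric {R N} M.

Section Curvature.
Context {R : realType} {N : nat} {M : manifold R N}.
Implicit Types (X Y Z : vf M) (f : cinf M).

Record levi_civita (g : pseudo_metric M) (D : vf M -> vf M -> vf M) : Prop := {
  lc_linear : forall f X Y Z, D (f *: X + Y) Z = f *: D X Z + D Y Z;
  lc_additive : forall X Y Z, D X (Y + Z) = D X Y + D X Z;
  lc_leibniz : forall f X Y, D X (f *: Y) = X f *: Y + f *: D X Y;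
  lc_torsion_free : forall X Y, D X Y - D Y X = bracket X Y;
  lc_metric : forall X Y Z,
    X (app_metric g Y Z) = app_metric g (D X Y) Z + app_metric g Y (D X Z)
}.

Variables (g : pseudo_metric M) (D : vf M -> vf M -> vf M).

(* This is the opposite of the most common sign convention. *)
Definition curv X Y Z : vf M :=
  D (bracket X Y) Z - (D X (D Y Z) - D Y (D X Z)).

(* R(u,v)w for tangent vectors at p, computed on arbitrary extensions of them to
   vector fields; the result does not depend on these, by tensoriality. *)
Definition curv_at (p : M) (u v w : tangent p) : tangent p :=
  xget 0 [set t | exists X Y Z,
    [/\ vf_at X p = u, vf_at Y p = v, vf_at Z p = w
      & t = vf_at (curv X Y Z) p]].

Definition ricci (p : M) (v w : tangent p) : R :=
  trace (N := N) (fun u : tangent p => curv_at u v w).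

Definition ricci_op (p : M) (v : tangent p) : tangent p :=
  xget 0 [set Sv | forall w, g p Sv w = ricci v w].

Definition scalar_curv (p : M) : R := trace (N := N) (@ricci_op p).

(* N = 2n+1, so that the coefficient is tau / (2n(2n+1)). *)
Definition concircular X Y Z (p : M) : tangent p :=
  vf_at (curv X Y Z) p - (scalar_curv p / (N.-1 * N)%:R) *:
    (g p (vf_at Y p) (vf_at Z p) *: vf_at X p -
     g p (vf_at X p) (vf_at Z p) *: vf_at Y p).

Definition concircularly_flat (xi : vf M) :=
  forall X Y p, concircular X Y xi p = 0.

End Curvature.

Section Paracontact.
Context {R : realType} {M : manifold R 3}.
Variables (phi : endo_field M) (xi : vf M) (eta : one_form M)
  (g : pseudo_metric M).

Record almost_paracontact_metric : Prop := {
  apm_signature : has_signature g 2 1;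
  apm_phi2 : forall p v, phi p (phi p v) = v - eta p v *: vf_at xi p;
  apm_eta_xi : forall p, eta p (vf_at xi p) = 1;
  apm_plus_rank : forall p, has_dim [set v | eta p v = 0 /\ phi p v = v] 1;
  apm_minus_rank : forall p, has_dim [set v | eta p v = 0 /\ phi p v = - v] 1;
  apm_compat : forall p u v,
    g p (phi p u) (phi p v) = - g p u v + eta p u * eta p v
}.

Definition nijenhuis (X Y : vf M) : vf M :=
  app_endo phi (app_endo phi (bracket X Y))
  + bracket (app_endo phi X) (app_endo phi Y)
  - app_endo phi (bracket (app_endo phi X) Y)
  - app_endo phi (bracket X (app_endo phi Y)).

Definition two_deta (X Y : vf M) : cinf M :=
  X (app_form eta Y) - Y (app_form eta X) - app_form eta (bracket X Y).

Definition normal := forall X Y, nijenhuis X Y - two_deta X Y *: xi = 0.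

Variable D : vf M -> vf M -> vf M.

(* The functions alpha and beta attached to a normal structure; they are unique,
   since 2a = trace (X |-> D X xi) and 2b = trace (X |-> phi (D X xi)). *)
Definition normal_functions (a b : cinf M) :=
  forall X, D X xi = a *: (X - app_form eta X *: xi) + b *: app_endo phi X.

Definition para_kenmotsu (alpha : R) :=
  [/\ almost_paracontact_metric, normal, alpha != 0
    & normal_functions (cinf_cst M alpha) 0].

End Paracontact.

(* Main.v *)
(* On an alpha-para Kenmotsu manifold eta = g(., xi) is closed, because
   g(Y, nabla_X xi) is symmetric in X and Y; substituting
   nabla_X xi = alpha (X - eta(X) xi) in the definition of the curvature gives
   R(X,Y)xi = alpha^2 (eta(Y) X - eta(X) Y), hence
   L(X,Y)xi = (alpha^2 - tau/6) (eta(Y) X - eta(X) Y).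
   The remaining point is that at every p some global vector field is not
   proportional to xi: coordinate fields of a chart, multiplied by a smooth
   bump function, provide one. *)
Require Import Defs.
From mathcomp Require Import all_boot all_order all_algebra.
From mathcomp Require Import all_classical all_reals all_analysis.
From mathcomp Require Import ring.
Set Implicit Arguments.
Unset Strict Implicit.
Unset Printing Implicit Defensive.
Import Order.TTheory GRing.Theory Num.Theory.
Import numFieldNormedType.Exports.
Local Open Scope classical_set_scope.
Local Open Scope ring_scope.

(** * A flat smooth function *)

Section FlatFunction.
Context {R : realType}.
Implicit Types (n : nat) (t : R).

(* This family is closed under differentiation up to linear combinations, see
   [is_derive_flat]; hence all its members are smooth. *)
Definition flat n t : R := if 0 < t then t ^- n * expR (- t^-1) else 0.

Lemma flat_gt0 n t : 0 < t -> 0 < flat n t.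
Proof. by move=> t0; rewrite /flat t0 mulr_gt0 ?expR_gt0 ?invr_gt0 ?exprn_gt0. Qed.

Lemma flat_le0 n t : t <= 0 -> flat n t = 0.
Proof. by rewrite /flat ltNge => ->. Qed.

Lemma norm_flat_le n t : `|flat n t| <= n.+2`!%:R * t ^+ 2.
Proof.
have [t0|t0] := leP t 0.
  by rewrite flat_le0// normr0 mulr_ge0// sqr_ge0.
rewrite gtr0_norm ?flat_gt0// /flat t0 expRN -invfM invf_ple; last 2 first.
- by rewrite posrE mulr_gt0 ?expR_gt0 ?exprn_gt0.
- by rewrite posrE mulr_gt0 ?exprn_gt0 ?ltr0n ?fact_gt0.
have := @expR_ge1Dxn R t^-1 n.+1 (ltW _); rewrite invr_gt0 => /(_ t0) h.
rewrite -ler_pdivrMl ?exprn_gt0//; apply: le_trans h.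
rewrite -[leLHS]add0r lerD//.
by rewrite invfM mulrCA mulrC exprVn -invfM -exprD addn2.
Qed.

Lemma is_derive_flat n t :
  is_derive t 1 (flat n) (flat n.+2 t - n%:R * flat n.+1 t).
Proof.
have [t0|t0|->] := ltgtP t 0.
- rewrite !flat_le0 ?(ltW t0)// mulr0 subr0.
  apply: (@near_eq_is_derive _ _ _ (cst 0)).
  by near=> u; rewrite flat_le0//; apply: ltW; near: u; exact: lt_nbhsl.
- have tN0 : t != 0 by rewrite gt_eqF.
  pose w : R -> R := fun u => u^-1.
  have wX u : (w ^+ n) u = u ^- n by rewrite exprfctE exprVn.
  apply: (@near_eq_is_derive _ _ _ (w ^+ n * (expR \o - w))).
  - near=> u; rewrite /flat ifT; last by near: u; exact: lt_nbhsr.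
    by rewrite -wX.
  - have dV : is_derive t 1 w (- t ^- 2).
      apply: is_derive_eq (is_deriveV tN0 (is_derive_id t 1)) _.
      by rewrite [LHS]mulr1.
    have dE : is_derive t 1 (expR \o - w) (expR (- t^-1) * t ^- 2).
      by apply: is_derive_eq; rewrite opprK.
    apply: is_derive_eq (is_deriveM (is_deriveX n dV) dE) _; rewrite /flat t0 /= wX -!exprVn.
    rewrite /GRing.scale /= /w; case: n {wX} => [|m] /=.
      by rewrite !exprS; ring.
    by rewrite !exprS; ring.
- rewrite !flat_le0// mulr0 subr0.
  have lim0 : h^-1 *: (flat n (h *: (1 : R) + 0) - flat n 0)
      @[h --> (0 : R)^'] --> (0 : R).
    rewrite (flat_le0 n (lexx 0)).
    apply/cvgrPdist_le => /= e e0; near=> h.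
    have h0 : h != 0 by near: h; exact: nbhs_dnbhs_neq.
    rewrite sub0r normrN subr0 addr0 normrZ [h *: 1]mulr1 normfV.
    rewrite ler_pdivrMl ?normr_gt0//.
    apply: le_trans (norm_flat_le n h) _.
    rewrite -real_normK ?num_real// expr2 mulrA [leRHS]mulrC ler_wpM2r//.
    rewrite -ler_pdivlMl ?ltr0n ?fact_gt0//.
    near: h; apply: dnbhs0_le.
    by rewrite mulr_gt0 ?invr_gt0 ?ltr0n ?fact_gt0.
  apply: DeriveDef; first by apply/cvg_ex; exists 0.
  exact: cvg_lim lim0.
Unshelve. all: by end_near.
Qed.

End FlatFunction.

(** * Calculus of C^k functions *)

Section CkCalculus.
Context {R : realType} {N : nat}.
Implicit Types (U V : set 'rV[R]_N) (f g u : 'rV[R]_N -> R) (k n : nat).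

(** The conditions in [Ck] are pointwise, so smoothness can be checked piecewise on a cover. *)
Lemma CkU k U V f : Ck k U f -> Ck k V f -> Ck k (U `|` V) f.
Proof.
elim: k f => [|k IHk] f; first by move=> fU fV x [/fU|/fV].
move=> [dU DU] [dV DV]; split=> [x [/dU|/dV]//|v].
exact: IHk (DU v) (DV v).
Qed.

Lemma CkS k U V f : U `<=` V -> Ck k V f -> Ck k U f.
Proof.
move=> UV; elim: k f => [|k IHk] f; first by move=> fV x /UV/fV.
by move=> [dV DV]; split=> [x /UV/dV//|v]; exact: IHk (DV v).
Qed.

Lemma Ck_sum k U n (f : 'I_n -> 'rV[R]_N -> R) : open U ->
  (forall i, Ck k U (f i)) -> Ck k U (\sum_i f i).
Proof.
move=> Uo Cf; elim/big_ind: _ => [|f1 f2 Cf1 Cf2|i _]; last exact: Cf.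
- exact: (Ck_cst k U (0 : R)).
- exact: CkD.
Qed.

Lemma derive_coord (x v : 'rV[R]_N) j : 'D_v (fun y : 'rV[R]_N => y 0 j) x = v 0 j.
Proof.
have := derive_mx (@derivable_id _ _ x v).
by rewrite derive_id => /rowP/(_ j); rewrite mxE.
Qed.

Lemma Ck_coord k U j : Ck k U (fun x => x 0 j).
Proof.
case: k => [|k]; first by move=> x _; exact: coord_continuous.
split=> [x _|v]; first exact: differentiable_coord.
rewrite (_ : (fun _ => _) = cst (v 0 j)); first exact: Ck_cst.
by apply/funext => x; exact: derive_coord.
Qed.

Lemma derive_flat_comp n u x v : differentiable u x ->
  'D_v (flat n \o u) x =
  (flat n.+2 (u x) - n%:R * flat n.+1 (u x)) * 'D_v u x.
Proof.
move=> du; have dfl := is_derive_flat n (u x).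
have dfl' : differentiable (flat n) (u x) by apply/derivable1_diffP.
rewrite deriveE; last exact: differentiable_comp.
by rewrite diff_comp//= diff1E// derive1E derive_val -deriveE// [LHS]mulrC.
Qed.

(** Induction on [k] for all [n] at once, since differentiating [flat n] brings in [flat n.+1] and
    [flat n.+2]. *)
Lemma Ck_flat_comp k U n u : open U -> Ck k U u -> Ck k U (flat n \o u).
Proof.
move=> Uo; have dfl m t : differentiable (@flat R m) t.
  by apply/derivable1_diffP; case: (is_derive_flat m t).
elim: k n => [|k IHk] n.
  move=> uc x Ux; apply: continuous_comp; first exact: uc.
  exact/differentiable_continuous.
move=> Cu; have [du Du] := Cu; split=> [x Ux|v].
  by apply: differentiable_comp; first exact: du.
apply: (@Ck_ext _ _ _ _
  ((flat n.+2 \o u + cst (- n%:R) * (flat n.+1 \o u)) *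
   (fun x => 'D_v u x))) => //.
  by move=> x Ux; rewrite derive_flat_comp; [rewrite -mulNr|exact: du].
have Cu' := CkSW Cu.
apply: CkM => //; last exact: Du.
apply: CkD => //; first exact: IHk.
by apply: CkM => //; [exact: Ck_cst|exact: IHk].
Qed.

Lemma differentiable_row (G : 'rV[R]_N -> 'rV[R]_N) x :
  (forall j, differentiable (fun y => G y 0 j) x) -> differentiable G x.
Proof.
move=> dG; rewrite (_ : G = \sum_j (fun y => G y 0 j *: delta_mx 0 j)).
  by apply: differentiable_sum => j; exact: differentiableZl.
by apply/funext => y; rewrite fct_sumE [LHS]row_sum_delta.
Qed.

Lemma derive_comp_row f (G : 'rV[R]_N -> 'rV[R]_N) x v :
  differentiable f (G x) -> differentiable G x ->
  'D_v (f \o G) x =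
  \sum_j 'D_(delta_mx 0 j) f (G x) * 'D_v (fun y => G y 0 j) x.
Proof.
move=> df dG; rewrite deriveE; last exact: differentiable_comp.
rewrite diff_comp//= -(deriveE v dG) derive_mx; last exact: diff_derivable.
rewrite [X in 'd f _ X]row_sum_delta linear_sum; apply: eq_bigr => j _.
by rewrite linearZ mxE -deriveE// [LHS]mulrC.
Qed.

(** By the chain rule, a derivative of [f \o G] is a sum of products in which the partial
    derivatives of [f] are again composed with [G]. The induction therefore runs over all [f]. *)
Lemma Ck_comp k U V f (G : 'rV[R]_N -> 'rV[R]_N) : open U ->
  (forall x, U x -> V (G x)) -> (forall x, U x -> {for x, continuous G}) ->
  (forall j, Ck k U (fun x => G x 0 j)) -> Ck k V f -> Ck k U (f \o G).
Proof.
move=> Uo UV Gc; elim: k f => [|k IHk] f CG Cf.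
  by move=> x Ux; apply: continuous_comp; [exact: Gc|exact/Cf/UV].
have dG x : U x -> differentiable G x.
  by move=> Ux; apply: differentiable_row => j; exact: (CG j).1.
have df x : U x -> differentiable f (G x) by move=> /UV /Cf.1.
split=> [x Ux|v]; first by apply: differentiable_comp; [exact: dG|exact: df].
apply: (@Ck_ext _ _ _ _ (\sum_j
    ((fun y => 'D_(delta_mx 0 j) f y) \o G) *
    (fun y => 'D_v (fun y => G y 0 j) y))) => //.
  by move=> x Ux; rewrite fct_sumE derive_comp_row; [|exact: df|exact: dG].
apply: Ck_sum => // j; apply: CkM => //.
  by apply: IHk; [move=> i; exact: CkSW|exact: Cf.2].
exact: (CG j).2.
Qed.

(** The Euclidean distance is written out because the norm on row vectors is the sup norm, whose
    square is not smooth in general. *)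
Definition sqdist (a x : 'rV[R]_N) : R := \sum_j (x 0 j - a 0 j) ^+ 2.

Definition euclid_bump (a : 'rV[R]_N) (r : R) : 'rV[R]_N -> R :=
  fun x => flat 0 (r ^+ 2 - sqdist a x).

Lemma Ck_bump k U a r : open U -> Ck k U (euclid_bump a r).
Proof.
move=> Uo; apply: Ck_flat_comp => //.
pose d j : 'rV[R]_N -> R := (fun x => x 0 j) + cst (- a 0 j).
rewrite (_ : (fun _ => _) = cst (r ^+ 2) + cst (-1) * \sum_j d j * d j); last first.
  apply/funext => x; rewrite -[RHS]/(r ^+ 2 + -1 * (\sum_j d j * d j) x) mulN1r.
  by congr (_ - _); rewrite fct_sumE; apply: eq_bigr => j _; rewrite expr2.
have Cd j : Ck k U (d j) by apply: CkD => //; [exact: Ck_coord|exact: Ck_cst].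
apply: CkD => //; first exact: Ck_cst.
apply: CkM => //; first exact: Ck_cst.
by apply: Ck_sum => // j; exact: CkM.
Qed.

Lemma bump_center a r : r != 0 -> euclid_bump a r a != 0.
Proof.
move=> r0; rewrite gt_eqF// flat_gt0// /sqdist big1 ?subr0 ?exprn_even_gt0//.
by move=> j _; rewrite subrr expr0n.
Qed.

(** [closed_ball] is a cube. It contains the Euclidean ball where the bump is positive, since each
    squared coordinate difference is a summand of [sqdist]. *)
Lemma bump_supp a r x : 0 < r -> ~ closed_ball a r x -> euclid_bump a r x = 0.
Proof.
move=> r0 ax; rewrite /euclid_bump flat_le0// subr_le0 leNgt; apply/negP => h.
apply: ax; rewrite closed_ballE// /closed_ball_ /= [leLHS]/Num.Def.normr /= mx_normrE.
apply: bigmax_le => [|[i j] _ /=]; first exact: ltW.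
rewrite ord1 !mxE distrC -(@ler_pXn2r _ 2) ?nnegrE ?(ltW r0)//.
rewrite real_normK ?num_real//; apply: le_trans (ltW h).
by rewrite /sqdist (bigD1 j)//= lerDl sumr_ge0// => i' _; exact: sqr_ge0.
Qed.

End CkCalculus.

(** * Bump functions and coordinate vector fields on a manifold *)

Lemma closed_ball_compact (R : realType) n (a : 'rV[R]_n) (r : R) :
  0 < r -> compact (closed_ball a r).
Proof.
move=> r0; apply: bounded_closed_compact; last exact: closed_ball_closed.
exists (`|a| + r); split; first exact: num_real.
move=> M aM x; rewrite closed_ballE// /closed_ball_ /= => ax.
apply: le_trans (ltW aM); rewrite -lerBlDl; apply: le_trans ax.
by rewrite distrC lerB_dist.
Qed.

Lemma open_chart_img (R : realType) N (M : topologicalType) (c : chart R N M) :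
  open (chart_img c).
Proof. exact: (@chart_img_open _ _ _ c). Qed.

Arguments open_chart_img {R N M} c.

Lemma chart_map_open (R : realType) N (M : topologicalType) (c : chart R N M)
    (A : set M) :
  open A -> open (chart_map c @` (chart_dom c `&` A)).
Proof.
move=> Ao; rewrite openE => _ [q [cq Aq] <-].
have cimg : chart_img c (chart_map c q) by exists q.
have inv_cont := chart_inv_cont cimg.
have nA : nbhs (chart_inv c (chart_map c q)) A.
  by rewrite (chart_mapK cq); exact: open_nbhs_nbhs.
have nA' : nbhs (chart_map c q) (chart_inv c @^-1` A) by exact: inv_cont.
have nimg : nbhs (chart_map c q) (chart_img c).
  exact: open_nbhs_nbhs (conj (open_chart_img c) cimg).
rewrite /interior /=; apply: filterS2 nimg nA'.
by move=> _ [q' cq' <-] /=; rewrite chart_mapK// => Aq'; exists q'.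
Qed.

Section BumpExtension.
Context {R : realType} {N : nat} {M : manifold R N}.
Variables (c : chart R N M) (a : 'rV[R]_N) (r : R).
Hypotheses (ac : atlas c) (r0 : 0 < r) (ar : closed_ball a r `<=` chart_img c).
Implicit Types (h : 'rV[R]_N -> R) (v : 'rV[R]_N) (f : cinf M) (q : M).

(** Off the chart domain the restriction [\_] takes the default value, which is 0 here. *)
Definition bump_ext h : M -> R :=
  ((euclid_bump a r * h) \o chart_map c) \_ (chart_dom c).

Lemma bump_extE h q : chart_dom c q ->
  bump_ext h q = euclid_bump a r (chart_map c q) * h (chart_map c q).
Proof. by move=> cq; rewrite /bump_ext patchT// inE. Qed.

(** A continuous image of a compact ball is compact, hence closed in a Hausdorff space. Its
    complement is thus an open set on which the extension by zero vanishes. *)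
Lemma closed_bump_supp : closed (chart_inv c @` closed_ball a r).
Proof.
apply: compact_closed; first exact: manifold_hausdorff.
apply: continuous_compact; last exact: closed_ball_compact.
apply: continuous_in_subspaceT => x; rewrite inE => /ar.
exact: chart_inv_cont.
Qed.

(** In another chart [d], two open sets cover the image. On the overlap with [c] the function is a
    smooth one composed with the transition map; off the compact set [K] it is zero. *)
Lemma smooth_bump_ext h : smooth_on (chart_img c) h -> smooth (bump_ext h).
Proof.
move=> sh d ad k.
pose K := chart_inv c @` closed_ball a r.
pose U1 := chart_map d @` (chart_dom d `&` chart_dom c).
pose U2 := chart_map d @` (chart_dom d `&` ~` K).
have U1o : open U1 by apply: chart_map_open; exact: chart_dom_open.
have U2o : open U2.
  by apply: chart_map_open; apply: closed_openC; exact: closed_bump_supp.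
have img_sub : chart_img d `<=` U1 `|` U2.
  move=> _ [q dq <-]; have [cq|ncq] := pselect (chart_dom c q); [left|right].
    by exists q.
  (* [K] lies inside the domain of [c], so a point outside that domain is outside [K]. *)
  exists q => //; split=> // -[x /ar [q' cq' <-]].
  by rewrite chart_mapK// => q'q; apply: ncq; rewrite -q'q.
apply: (CkS img_sub); apply: CkU.
- have invU1 x : U1 x -> [/\ chart_dom d (chart_inv d x),
      chart_dom c (chart_inv d x) & chart_map d (chart_inv d x) = x].
    by move=> [q [dq cq] <-]; rewrite chart_mapK.
  pose G x := chart_map c (chart_inv d x).
  apply: (@Ck_ext _ _ _ _ ((euclid_bump a r * h) \o G)) => //.
    by move=> x /invU1[_ cx _]; rewrite /= bump_extE.
  apply: (@Ck_comp _ _ _ _ (chart_img c)) => //.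
  + by move=> x /invU1[_ cx _]; exists (chart_inv d x).
  + move=> x /invU1[dx cx dK]; apply: continuous_comp.
      by apply: chart_inv_cont; exists (chart_inv d x).
    exact: chart_map_cont.
  + by move=> j; exact: (atlas_compatible ad ac).
  + apply: CkM; [exact: open_chart_img|apply: Ck_bump; exact: open_chart_img|].
    exact: sh.
- apply: (@Ck_ext _ _ _ _ (cst 0)) => //; last exact: Ck_cst.
  move=> _ [q [dq nKq] <-]; rewrite /= chart_mapK//.
  have [cq|ncq] := pselect (chart_dom c q); last first.
    by rewrite /bump_ext patchC// inE.
  rewrite bump_extE// bump_supp ?mul0r// => acq.
  by apply: nKq; exists (chart_map c q) => //; exact: chart_mapK.
Qed.

Lemma smooth_on_derive f v :
  smooth_on (chart_img c) (fun x => 'D_v (f \o chart_inv c) x).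
Proof. by move=> k; exact: (cinf_smooth f ac k.+1).2. Qed.

(** Vector fields act on global functions, so the constant field [v] of the chart has to be cut off
    by the bump. The derivation rules are those of ['D_v] on the chart domain and read [0 = 0]
    elsewhere. *)
Fact bump_vf_subproof v :
  (fun f => mk_cinf (smooth_bump_ext (smooth_on_derive f v)) : (cinf M)^o)
    \in vf_pred.
Proof.
pose fc (f : cinf M) : 'rV[R]_N -> R := f \o chart_inv c.
have dc f q : chart_dom c q -> derivable (fc f) (chart_map c q) v.
  move=> cq; apply: diff_derivable.
  by apply: (cinf_smooth f ac 1).1; exists q.
apply/asboolP; split=> [s f g|f g]; apply: cinf_eq => q; rewrite !cinfE /=;
  have [cq|ncq] := pselect (chart_dom c q).
- rewrite !bump_extE//.
  rewrite [X in derive X _ _](_ : _ = s *: fc f + fc g)//.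
  rewrite deriveD; [|exact/derivableZ/dc|exact: dc].
  by rewrite deriveZ; [rewrite /fc /GRing.scale /=; ring|exact: dc].
- by rewrite /bump_ext !patchC ?inE//= !mulr0 addr0.
- rewrite !bump_extE//.
  rewrite [X in derive X _ _](_ : _ = fc f * fc g)//.
  rewrite deriveM; [|exact: dc|exact: dc].
  by rewrite /fc /GRing.scale /= chart_mapK//; ring.
- by rewrite /bump_ext !patchC ?inE//= !mulr0 addr0.
Qed.

Definition bump_vf v : vf M := VF (bump_vf_subproof v).

End BumpExtension.

(** The fields are cut-off coordinate fields, the functions cut-off and rescaled coordinates centred
    at [p]. The duality shows that the fields have linearly independent values at [p]. *)
Lemma exists_dual_vf (R : realType) N (M : manifold R N) (p : M) :
  exists (X : 'I_N -> vf M) (f : 'I_N -> cinf M),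
    forall i j, (X i (f j) : cinf M) p = (i == j)%:R.
Proof.
have [c ac cp] := atlas_cover p; pose a := chart_map c p.
have aimg : chart_img c a by exists p.
have := open_nbhs_nbhs (conj (open_chart_img c) aimg).
move=> /nbhs_closedballP[r ar].
have r0 : 0 < r%:num by [].
pose b := euclid_bump a r%:num a; have b0 : b != 0 by exact: bump_center.
pose u j : 'rV[R]_N -> R := (fun x : 'rV[R]_N => x 0 j) + cst (- a 0 j).
(* The field and the function each contribute one factor [b], the value of the bump at [a]; [b ^- 2]
   cancels both. *)
pose h j := cst (b ^- 2) * u j.
have sh j : smooth_on (chart_img c) (h j).
  move=> k; have imo := open_chart_img c; apply: CkM => //; first exact: Ck_cst.
  by apply: CkD => //; [exact: Ck_coord|exact: Ck_cst].
exists (fun i => bump_vf ac r0 ar (delta_mx 0 i)).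
exists (fun j => mk_cinf (smooth_bump_ext ac r0 ar (sh j))) => i j /=.
rewrite bump_extE// -/a -/b.
have -> : 'D_(delta_mx 0 i) (bump_ext c a r%:num (h j) \o chart_inv c) a =
          'D_(delta_mx 0 i) (euclid_bump a r%:num * h j) a.
  apply: near_eq_derive.
  apply: filterS (open_nbhs_nbhs (conj (open_chart_img c) aimg)).
  by move=> _ [q cq <-] /=; rewrite chart_mapK// bump_extE.
have dbump : derivable (euclid_bump a r%:num) a (delta_mx 0 i).
  by apply: diff_derivable; apply: (Ck_bump 1 a r%:num (@openT _)).1.
have dcoord :
    is_derive a (delta_mx 0 i) (fun x : 'rV[R]_N => x 0 j) (i == j)%:R.
  apply: DeriveDef; first exact/diff_derivable/differentiable_coord.
  by rewrite derive_coord mxE /= eq_sym.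
have du : is_derive a (delta_mx 0 i) (u j) (i == j)%:R.
  apply: is_derive_eq (is_deriveD dcoord (is_derive_cst (- a 0 j) a _)) _.
  by rewrite addr0.
have dh : is_derive a (delta_mx 0 i) (h j) (b ^- 2 * (i == j)%:R).
  apply: is_derive_eq (is_deriveM (is_derive_cst (b ^- 2) a _) du) _.
  by rewrite scaler0 addr0.
(* Centring the coordinate at [a] removes the term containing the derivative of the bump. *)
have ha : h j a = 0 by rewrite -[LHS]/(b ^- 2 * (a 0 j - a 0 j)) subrr mulr0.
rewrite deriveM//.
rewrite derive_val ha scale0r addr0 /GRing.scale /=.
by rewrite !mulrA -expr2 divff ?mul1r// expf_neq0.
Qed.

(** * Curvature of para Kenmotsu manifolds *)

Section VectorFields.
Context {R : realType} {N : nat} {M : manifold R N}.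
Implicit Types (X Y : vf M) (f a : cinf M) (p : M).

Lemma vf_eq X Y : (forall f p, (X f : cinf M) p = (Y f : cinf M) p) -> X = Y.
Proof. by move=> XY; apply/val_inj/funext => f; apply: cinf_eq => p; exact: XY. Qed.

Lemma vf_atD X Y p : vf_at (X + Y) p = vf_at X p + vf_at Y p.
Proof. exact/val_inj. Qed.

Lemma vf_atN X p : vf_at (- X) p = - vf_at X p.
Proof. exact/val_inj. Qed.

Lemma vf_atZ a X p : vf_at (a *: X) p = a p *: vf_at X p.
Proof. exact/val_inj. Qed.

Definition vf_atE := (vf_atD, vf_atN, vf_atZ).

Lemma vf0 X p : (X 0 : cinf M) p = 0.
Proof.
have /(congr1 (fun f : cinf M => f p)) := (vfP X).1 (- 1) 0 0.
by rewrite scaler0 addr0 !cinfE mulN1r addNr.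
Qed.

(** The Leibniz rule for [1 * 1] gives [X 1 = X 1 + X 1]; linearity does the rest. *)
Lemma vf_cst X (s : R) p : (X (cinf_cst M s) : cinf M) p = 0.
Proof.
have [XL XM] := vfP X.
have X1 : (X 1 : cinf M) p = 0.
  have /(congr1 (fun f : cinf M => f p)) := XM 1 1.
  rewrite mul1r cinfE !cinfM !mul1r => /eqP.
  by rewrite -subr_eq0 opprD addNKr oppr_eq0 => /eqP.
have /(congr1 (fun f : cinf M => f p)) := XL s 1 0.
have -> : s *: (1 : cinf M) + 0 = cinf_cst M s.
  by apply: cinf_eq => q; rewrite addr0 cinfZ [LHS]mulr1.
by move=> ->; rewrite !cinfE X1 vf0 mulr0 addr0.
Qed.

End VectorFields.

Section Metric.
Context {R : realType} {N : nat} {M : manifold R N} (g : pseudo_metric M).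
Context (p : M).
Implicit Types u v w : tangent p.

Lemma metricC u v : g p u v = g p v u.
Proof. exact: Defs.metric_sym. Qed.

Lemma metric0r u : g p u 0 = 0.
Proof.
have := metric_linear g (-1) 0 0 u.
by rewrite scaler0 addr0 mulN1r addNr metricC.
Qed.

Lemma metricDr u v w : g p u (v + w) = g p u v + g p u w.
Proof. by rewrite !(metricC u) -[v]scale1r metric_linear mul1r scale1r. Qed.

Lemma metricZr (a : R) u v : g p u (a *: v) = a * g p u v.
Proof.
rewrite -[a *: v]addr0 metricC metric_linear !(metricC _ u).
by rewrite metric0r addr0.
Qed.

Lemma metricNr u v : g p u (- v) = - g p u v.
Proof. by rewrite -scaleN1r metricZr mulN1r. Qed.

End Metric.

(** * The form [eta] and the curvature applied to [xi] *)

Section Paracontact.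
Context {R : realType} {M : manifold R 3}.
Variables (phi : endo_field M) (xi : vf M) (eta : one_form M)
  (g : pseudo_metric M).
Hypothesis apm : almost_paracontact_metric phi xi eta g.

(** The formula for [phi^2] kills [xi]; applied to [phi xi] it then gives [phi xi = s xi] with
    [s = eta (phi xi)]. Hence [0 = phi^2 xi = s^2 xi], and applying [eta] yields [s = 0]. *)
Lemma phi_xi p : phi p (vf_at xi p) = 0.
Proof.
have eta_xi := apm_eta_xi apm p; have phi2 := apm_phi2 apm (p := p).
have phi2_xi : phi p (phi p (vf_at xi p)) = 0.
  by rewrite phi2 eta_xi scale1r subrr.
have phi_xiE : phi p (vf_at xi p) = eta p (phi p (vf_at xi p)) *: vf_at xi p.
  apply/eqP; rewrite -subr_eq0; apply/eqP.
  by rewrite -phi2 phi2_xi linear0.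
move: phi2_xi; rewrite phi_xiE; set s := eta p _.
rewrite linearZ /= phi_xiE -/s scalerA => /(congr1 (eta p)).
rewrite linearZ linear0 /= eta_xi mulr1 => /eqP.
by rewrite mulf_eq0 orbb => /eqP ->; rewrite scale0r.
Qed.

Lemma eta_metric p v : eta p v = g p v (vf_at xi p).
Proof.
have := apm_compat apm v (vf_at xi p).
rewrite phi_xi (apm_eta_xi apm) mulr1.
rewrite metric0r.
by move=> /esym/eqP; rewrite addrC subr_eq0 => /eqP.
Qed.

Variables (D : vf M -> vf M -> vf M) (alpha : R).
Hypotheses (lc : levi_civita g D)
  (Dxi : normal_functions phi xi eta D (cinf_cst M alpha) 0).
Implicit Types X Y : vf M.

(** Metric compatibility splits [X (g(Y, xi))] into [g(D X Y, xi)] and a term symmetric in [X] and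
    [Y]. The symmetric terms cancel, and zero torsion turns the rest into the bracket. *)
Lemma eta_closed X Y p :
  (X (app_form eta Y) : cinf M) p - (Y (app_form eta X) : cinf M) p =
  eta p (vf_at (bracket X Y) p).
Proof.
have appE Z : app_form eta Z = app_metric g Z xi.
  by apply: cinf_eq => q; exact: eta_metric.
have metricDxi Z W : g p (vf_at Z p) (vf_at (D W xi) p) =
    alpha * (g p (vf_at Z p) (vf_at W p) -
      eta p (vf_at W p) * eta p (vf_at Z p)).
  rewrite Dxi scale0r addr0 vf_atZ vf_atD vf_atN vf_atZ.
  by rewrite metricZr metricDr metricNr metricZr -eta_metric.
rewrite !appE !(lc_metric lc) !cinfE /= !metricDxi.
rewrite metricC -eta_metric (metricC _ (vf_at xi p)) -eta_metric.
rewrite -(lc_torsion_free lc) vf_atD vf_atN linearB /=.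
by rewrite (metricC g (vf_at X p)); ring.
Qed.

Lemma curv_xi X Y : curv D X Y xi =
  cinf_cst M (alpha ^+ 2) *: (app_form eta Y *: X - app_form eta X *: Y).
Proof.
have DN W Z : D W (- Z) = - D W Z.
  apply: (@addIr _ (D W Z)); rewrite addNr -(lc_additive lc) addNr.
  by apply: (@addIr _ (D W 0)); rewrite add0r -(lc_additive lc) addr0.
have DDxi W Z : D W (D Z xi) = cinf_cst M alpha *: (D W Z
    - (W (app_form eta Z) *: xi + app_form eta Z *: D W xi)).
  rewrite (Dxi Z) scale0r addr0 (lc_leibniz lc) (lc_additive lc) DN.
  rewrite (lc_leibniz lc).
  have -> : W (cinf_cst M alpha) = 0 by apply: cinf_eq => q; exact: vf_cst.
  by rewrite scale0r add0r.
rewrite /curv !DDxi !Dxi !scale0r !addr0.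
(* Eliminating [D X Y] and [eta] of the bracket leaves only independent quantities, so the claim
   becomes a polynomial identity in the values at a point. *)
have DXY : D X Y = bracket X Y + D Y X by rewrite -(lc_torsion_free lc) subrK.
have etaB : app_form eta (bracket X Y) =
    (X (app_form eta Y) : cinf M) - (Y (app_form eta X) : cinf M).
  by apply: cinf_eq => p; rewrite !cinfE eta_closed.
rewrite DXY etaB.
move: (app_form eta X) (app_form eta Y) (D Y X) (bracket X Y) => a b W B.
move: (X b : cinf M) (Y a : cinf M) => Xb Ya.
apply: vf_eq => f p; pose ev (Z : vf M) : R := (Z f : cinf M) p.
have evD Z Z' : ev (Z + Z') = ev Z + ev Z' by [].
have evN Z : ev (- Z) = - ev Z by [].
have evZ (h : cinf M) Z : ev (h *: Z) = h p * ev Z by [].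
(* [ev] must be abstract here: otherwise unification unfolds the subtype
   structures of [cinf] and [vf] and diverges. *)
rewrite -[LHS]/(ev _) -[RHS]/(ev _).
move: ev evD evN evZ => ev evD evN evZ.
rewrite !(evD, evN, evZ).
have cE (s : R) : cinf_cst M s p = s by [].
rewrite !cE cinfD cinfN; ring.
Qed.

Lemma concircular_xi X Y p :
  concircular g D X Y xi p = (alpha ^+ 2 - scalar_curv g D p / 6) *:
    (eta p (vf_at Y p) *: vf_at X p - eta p (vf_at X p) *: vf_at Y p).
Proof.
(* The denominator [(3.-1 * 3)%:R] is 6 by computation. *)
rewrite /concircular curv_xi -!eta_metric scalerBl; congr (_ - _).
by rewrite !vf_atE.
Qed.

End Paracontact.

Theorem theorem4p1 (R : realType) (M : manifold R 3)
    (phi : endo_field M) (xi : vf M) (eta : one_form M) (g : pseudo_metric M)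
    (D : vf M -> vf M -> vf M) (alpha : R) :
  levi_civita g D ->
  para_kenmotsu phi xi eta g D alpha ->
  (concircularly_flat g D xi <->
   forall p : M, scalar_curv g D p = 6 * alpha ^+ 2).
Proof.
move=> lc [apm _ _ Dxi]; split=> [flat_xi p|tau X Y p]; last first.
  by rewrite (concircular_xi apm lc Dxi) tau mulrAC divff ?mul1r ?subrr ?scale0r.
have [X [f Xf]] := exists_dual_vf p.
set k := alpha ^+ 2 - scalar_curv g D p / 6.
suff /eqP : k = 0.
  by rewrite subr_eq0 => /eqP ->; rewrite mulrCA divff ?mulr1.
apply/eqP; apply: contraT => k0.
(* Flatness on the pair [Z], [xi], divided by [k], makes every field proportional to [xi] at [p]. *)
have XE (Z : vf M) (h : cinf M) :
    (Z h : cinf M) p = eta p (vf_at Z p) * (xi h : cinf M) p.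
  have /eqP := flat_xi Z xi p; rewrite (concircular_xi apm lc Dxi) -/k.
  rewrite scaler_eq0 (negbTE k0) (apm_eta_xi apm) scale1r subr_eq0 => /eqP.
  by move=> /(congr1 (fun v : tangent p => v h)).
(* Two of the dual fields suffice: the off-diagonal 0 forces a factor to vanish that also occurs in
   a diagonal entry equal to 1. *)
have := XE (X ord0) (f ord0); have := XE (X ord0) (f ord_max).
have := XE (X ord_max) (f ord_max); rewrite !Xf /= => e11 e01 e00.
move/esym/eqP: e01; rewrite mulf_eq0 => /orP[/eqP z|/eqP z].
  by move/eqP: e00; rewrite z mul0r oner_eq0.
by move/eqP: e11; rewrite z mulr0 oner_eq0.
Qed.
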